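(* Let $r \in (0,1)$. For each $n \ge 1$ let $p_n(z) = \sum_{k=0}^{n} a_k z^k$, where the $a_k$ are i.i.d. standard complex Gaussian random variables $N_{\mathbb{C}}(0,1)$, and let $\Lambda_n = \{z \in \mathbb{C} : |p_n(z)| = 1\}$. Then there is a constant $c_r > 0$, depending on $r$ but not on $n$, such that for every $n \ge 1$, with probability at least $c_r$ the set $\Lambda_n$ has a connected component of length at least $2\pi r$.
   Context: A random variable has the standard complex Gaussian distribution $N_{\mathbb{C}}(0,1)$ if it has density $\frac{1}{\pi} e^{-|z|^2}$ on $\mathbb{C}$ with respect to Lebesgue measure. Length means arc length (one-dimensional Hausdorff measure). *)

(* Defs.v *)
From HB Require Import structures.
From mathcomp Require Import all_boot all_order all_algebra.
From mathcomp Require Import complex.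
From mathcomp Require Import all_classical all_reals all_analysis.

Set Implicit Arguments.
Unset Strict Implicit.
Unset Printing Implicit Defensive.

Import Order.TTheory GRing.Theory Num.Theory.
Import numFieldNormedType.Exports.

Local Open Scope classical_set_scope.
Local Open Scope complex_scope.
Local Open Scope ring_scope.

(* R[i] carries no measurable structure in the library: its Borel sets are
   those of the plane, through this identification. *)
Definition plane_of_complex (R : realType) (z : R[i]) :
    measurableTypeR R * measurableTypeR R :=
  (complex.Re z, complex.Im z).

Definition cmodulus (R : realType) (z : R[i]) : R := complex.Re `|z|.

Definition std_complex_gaussian_density (R : realType) (z : R[i]) : R :=
  pi^-1 * expR (- cmodulus z ^+ 2).

Definition std_complex_gaussian (R : realType) (d : measure_display)
    (T : measurableType d) (P : probability T R) (X : T -> R[i]) : Prop :=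
  measurable_fun [set: T] (@plane_of_complex R \o X) /\
  forall B : set (measurableTypeR R * measurableTypeR R), measurable B ->
    P ((@plane_of_complex R \o X) @^-1` B) =
    (\int[(@lebesgue_measure R \x @lebesgue_measure R)%E]_(z in B)
       (std_complex_gaussian_density (z.1 +i* z.2))%:E)%E.

Definition mutually_independent (R : realType) (d d' : measure_display)
    (T : measurableType d) (T' : measurableType d') (P : probability T R)
    (I : finType) (X : I -> T -> T') : Prop :=
  forall (J : {set I}) (B : I -> set T'),
    (forall j, j \in J -> measurable (B j)) ->
    P (\bigcap_(j in [set` J]) (X j @^-1` B j)) =
    (\prod_(j in J) P (X j @^-1` B j))%E.

Definition iid_std_complex_gaussian (R : realType) (d : measure_display)
    (T : measurableType d) (P : probability T R)
    (I : finType) (X : I -> T -> R[i]) : Prop :=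
  (forall i, std_complex_gaussian P (X i)) /\
  mutually_independent P (fun i => @plane_of_complex R \o X i).

(* 0 is adjoined so that the diameter of the empty set is 0 and not -oo. *)
Definition ediam (R : realType) (U : set R[i]) : \bar R :=
  ereal_sup (0%E |` [set (cmodulus (z.1 - z.2))%:E | z in U `*` U]).

Definition hausdorff1_premeasure (R : realType) (delta : R) (A : set R[i]) :
    \bar R :=
  ereal_inf [set (\sum_(0 <= i <oo) ediam (U i))%E | U in
    [set U : nat -> set R[i] |
      A `<=` \bigcup_i U i /\ forall i, (ediam (U i) <= delta%:E)%E]].

(* Normalised so that a segment has its usual length. *)
Definition hausdorff1 (R : realType) (A : set R[i]) : \bar R :=
  ereal_sup [set hausdorff1_premeasure delta A | delta in
    [set delta : R | 0 < delta]].

Definition lemniscate (R : realType) (p : {poly R[i]}) : set R[i] :=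
  [set z | cmodulus p.[z] = 1].

(* R[i]^o is R[i] with the topology of the norm. *)
Definition is_component (R : realType) (A C : set R[i]) : Prop :=
  exists2 z : R[i]^o, A z & C = connected_component (A : set R[i]^o) z.

(* Main.v *)
(* With probability bounded below uniformly in n, a_1 lies in a small rectangle
   inside the annulus 1 < |z| < 1/r and |a_k| <= eta q^k for every k <> 1, for some
   q > 1: these constraints weaken so fast with k that the product of their
   probabilities converges. On a disk |z| <= rho with r < rho < 1 one then has
   p = a_1 z + g with g small and L-Lipschitz, where |a_1| + L < 1/r. For each t the
   contraction z |-> (e^(it) - g z) / a_1 has a fixed point zeta t, that is,
   p (zeta t) = e^(it). The curve zeta is continuous, hence lies in one component of
   the lemniscate, and p is an (|a_1| + L)-Lipschitz map from it onto the unit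
   circle, so that its length is at least 2 pi / (|a_1| + L) >= 2 pi r. *)

Require Import Defs.
From HB Require Import structures.
From mathcomp Require Import all_boot all_order all_algebra.
From mathcomp Require Import complex.
From mathcomp Require Import all_classical all_reals all_analysis.
From mathcomp Require Import measurable_realfun.
From mathcomp Require Import ring lra.

Set Implicit Arguments.
Unset Strict Implicit.
Unset Printing Implicit Defensive.

Import Order.TTheory GRing.Theory Num.Theory.
Import numFieldNormedType.Exports.
Import ComplexField.Normc.

Local Open Scope classical_set_scope.
Local Open Scope complex_scope.
Local Open Scope ring_scope.

(** * Modulus on [R[i]] *)

Section modulus.
Variable R : realType.
Implicit Types z w : R[i].

Lemma cmodulusE z : cmodulus z = normc z.
Proof. by case: z => x y; rewrite /cmodulus normc_def. Qed.

Lemma cmodulus_sqrt x y : cmodulus (x +i* y : R[i]) = Num.sqrt (x ^+ 2 + y ^+ 2).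
Proof. by rewrite cmodulusE. Qed.

Lemma normr_cmodulus z : `|z| = (cmodulus z)%:C.
Proof. by rewrite /cmodulus normc_def. Qed.

Lemma cmodulusM z w : cmodulus (z * w) = cmodulus z * cmodulus w.
Proof. by rewrite !cmodulusE normcM. Qed.

Lemma cmodulusN z : cmodulus (- z) = cmodulus z.
Proof. by rewrite !cmodulusE normcN. Qed.

Lemma cmodulusB z w : cmodulus (z - w) = cmodulus (w - z).
Proof. by rewrite -cmodulusN opprB. Qed.

Lemma ler_cmodulusD z w : cmodulus (z + w) <= cmodulus z + cmodulus w.
Proof. by rewrite !cmodulusE le_normcD. Qed.

Lemma cmodulus_ge0 z : 0 <= cmodulus z.
Proof. by case: z => x y; rewrite cmodulus_sqrt sqrtr_ge0. Qed.

Lemma cmodulus_eq0 z : cmodulus z = 0 -> z = 0.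
Proof. by rewrite cmodulusE => /eq0_normc. Qed.

Lemma cmodulus0 : cmodulus (0 : R[i]) = 0.
Proof. by rewrite cmodulusE normc0. Qed.

Lemma cmodulus1 : cmodulus (1 : R[i]) = 1.
Proof. by rewrite cmodulusE normc1. Qed.

Lemma cmodulusX z n : cmodulus (z ^+ n) = cmodulus z ^+ n.
Proof. by elim: n => [|n IH]; rewrite ?expr0 ?cmodulus1// !exprS cmodulusM IH. Qed.

Lemma cmodulusV z : cmodulus z^-1 = (cmodulus z)^-1.
Proof. by rewrite !cmodulusE normcV. Qed.

Lemma ler_cmodulusB z w : cmodulus (z - w) <= cmodulus z + cmodulus w.
Proof. by rewrite (le_trans (ler_cmodulusD _ _))// cmodulusN. Qed.

Lemma ler_dist_cmodulus z w : `|cmodulus z - cmodulus w| <= cmodulus (z - w).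
Proof.
rewrite ler_norml; apply/andP; split.
  rewrite cmodulusB lerNl opprB lerBlDr.
  by rewrite -[leLHS](_ : cmodulus (w - z + z) = _) ?ler_cmodulusD// subrK.
rewrite lerBlDr.
by rewrite -[leLHS](_ : cmodulus (z - w + w) = _) ?ler_cmodulusD// subrK.
Qed.

Lemma ler_cmodulus_sum (I : Type) (s : seq I) (P : pred I) (F : I -> R[i]) :
  cmodulus (\sum_(i <- s | P i) F i) <= \sum_(i <- s | P i) cmodulus (F i).
Proof.
elim/big_rec2: _ => [|i x z _ zx]; first by rewrite cmodulus0.
by rewrite (le_trans (ler_cmodulusD _ _))// lerD2l.
Qed.

Lemma cmodulus_le_ReIm x y : cmodulus (x +i* y : R[i]) <= `|x| + `|y|.
Proof.
rewrite cmodulus_sqrt -[leRHS]ger0_norm ?addr_ge0// -sqrtr_sqr ler_sqrt ?sqr_ge0//.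
rewrite -[x ^+ 2](real_normK (num_real x)) -[y ^+ 2](real_normK (num_real y)).
rewrite sqrrD -addrA [_ *+ 2 + _]addrC addrA.
by rewrite lerDl mulrn_wge0// mulr_ge0.
Qed.

Lemma ler_Re_cmodulus x y : `|x| <= cmodulus (x +i* y : R[i]).
Proof. by rewrite cmodulus_sqrt -sqrtr_sqr ler_wsqrtr// lerDl sqr_ge0. Qed.

Lemma ler_Im_cmodulus x y : `|y| <= cmodulus (x +i* y : R[i]).
Proof. by rewrite cmodulus_sqrt -sqrtr_sqr ler_wsqrtr// lerDr sqr_ge0. Qed.

End modulus.

(** * Chords and arcs of the unit circle *)

Section circle.
Variable R : realType.

Definition expi (t : R) : R[i] := cos t +i* sin t.

Lemma cmodulus_expi t : cmodulus (expi t) = 1.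
Proof. by rewrite cmodulus_sqrt cos2Dsin2 sqrtr1. Qed.

Lemma cmodulus_expiB s t : cmodulus (expi t - expi s) = 2 * `|sin ((t - s) / 2)|.
Proof.
rewrite /expi /= cmodulus_sqrt -[RHS]ger0_norm ?mulr_ge0// -sqrtr_sqr; congr Num.sqrt.
rewrite exprMn real_normK ?num_real// sin2cos2.
(* The cosine of [t - s] is expanded twice, by the difference formula and by the double-angle
   formula. *)
have e : cos (t - s) = cos (((t - s) / 2) *+ 2) by congr cos; field.
move: e; rewrite cosB cos_mulr2n => e.
have := cos2Dsin2 s; have := cos2Dsin2 t.
move: e; move: (cos s) (sin s) (cos t) (sin t) (cos ((t - s) / 2)) => a b c d u e ht hs.
nra.
Qed.

(** By the chord formula this reduces to [|sin x| <= |x|], a consequence of the mean value theorem;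
    it serves for the continuity of the lifted curve. *)
Lemma expi_lipschitz s t : cmodulus (expi t - expi s) <= `|t - s|.
Proof.
have sin_le (x : R) : 0 <= x -> sin x <= x.
  rewrite le_eqVlt => /predU1P[<-|x0]; first by rewrite sin0.
  have [|c _] := @MVT R sin cos 0 x x0.
  - by apply: continuous_subspaceT => y; exact: continuous_sin.
  by rewrite sin0 !subr0 => ->; rewrite ler_piMl ?cos_le1// ltW.
have abs_sin_le (x : R) : `|sin x| <= `|x|.
  wlog x0 : x / 0 <= x.
    move=> H; have [/H//|x0] := leP 0 x.
    by rewrite -normrN -[leRHS]normrN -sinN H// oppr_ge0 ltW.
  rewrite [leRHS]ger0_norm// ler_norml sin_le// andbT.
  have [x1|x1] := leP x 1.
    rewrite (le_trans _ (sin_ge0_pi _))// ?oppr_le0// x0/=.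
    by rewrite (le_trans x1)// (le_trans _ (pi_ge2 _))// ler1n.
  by rewrite (le_trans _ (sin_geN1 _))// lerN2 ltW.
rewrite cmodulus_expiB (le_trans (ler_wpM2l _ (abs_sin_le _)))//.
by rewrite normrM [`|2^-1|]ger0_norm// mulrCA divff// mulr1.
Qed.

(** Mean value theorem: [sin x = cos c * x] with [c < x <= y], and [cos] decreases on [[0, pi]]. *)
Lemma sin_ge_mul_cos (x y : R) : 0 <= x <= y -> y < pi / 2 -> cos y * x <= sin x.
Proof.
case/andP; rewrite le_eqVlt => /predU1P[<- _ _|x0 xy ypi]; first by rewrite sin0 mulr0.
have [|c /itvP cx] := @MVT R sin cos 0 x x0.
- by apply: continuous_subspaceT => z; exact: continuous_sin.
rewrite sin0 !subr0 => ->; rewrite ler_pM2r//.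
have ppi : y <= pi by rewrite (le_trans (ltW ypi))// ler_pdivrMr// ler_peMr ?pi_ge0// ler1n.
have cy : c <= y by rewrite (le_trans _ xy)// cx.
by rewrite leNgt ltr_cos -?leNgt// in_itv/= ?cx/= ?(le_trans cy)// (le_trans (ltW x0) xy).
Qed.

(** The reflection [x |-> pi - x] reduces to [x <= pi / 2], where [sin] increases. *)
Lemma sin_ge_away (x y : R) : 0 <= y <= pi / 2 -> y <= x <= pi - y -> sin y <= sin x.
Proof.
move=> /andP[y0 y1] /andP[yx xy].
wlog x1 : x yx xy / x <= pi / 2.
  move=> H; have [/(H _ yx xy)//|x1] := leP x (pi / 2).
  have -> : sin x = sin (pi - x) by rewrite sinB sinpi cospi mul0r sub0r mulN1r opprK.
  by apply: H; lra.
by rewrite leNgt ltr_sin -?leNgt// in_itv/=; apply/andP; split; lra.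
Qed.

End circle.

(** * Lipschitz continuity and fixed points in a disk *)

Lemma lipschitz_within_continuous (K : numFieldType) (V W : normedModType K)
    (A : set V) (f : V -> W) (k : K) : 0 <= k ->
  (forall u v, A u -> A v -> `|f u - f v| <= k * `|u - v|) ->
  {within A, continuous f}.
Proof.
(* Dividing by [k + 1] also covers [k = 0]. *)
move=> k0 fk; have k1 : 0 < k + 1 by rewrite ltr_wpDl.
apply/subspace_continuousP => u Au.
apply/cvgrPdist_lt => e e0; near=> v.
have Av : A v by near: v; exact: withinT.
rewrite (le_lt_trans (fk _ _ Au Av))//.
rewrite (@le_lt_trans _ _ ((k + 1) * `|u - v|))//.
  by rewrite ler_wpM2r// lerDl.
rewrite mulrC -ltr_pdivlMr//; near: v.
apply: cvg_within; apply: (@cvgr_dist_lt _ _ _ (nbhs u)) => //.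
by rewrite divr_gt0.
Unshelve. all: by end_near. Qed.

(* The minimum of |F z - z| over the disk is attained; were it nonzero, F would decrease it. *)
Lemma disk_contraction_fixpoint (R : realType) (rho q : R) (F : R[i] -> R[i]) :
  0 <= rho -> q < 1 ->
  (forall z, cmodulus z <= rho -> cmodulus (F z) <= rho) ->
  (forall z w, cmodulus z <= rho -> cmodulus w <= rho ->
    cmodulus (F z - F w) <= q * cmodulus (z - w)) ->
  exists2 z, cmodulus z <= rho & F z = z.
Proof.
move=> rho0 q1 Frho Fq.
pose c (v : R * R) : R[i] := v.1 +i* v.2.
have cB u v : cmodulus (c u - c v) <= 2 * `|u - v|.
  rewrite (le_trans (cmodulus_le_ReIm _ _))// mulr_natl mulr2n.
  by rewrite lerD// prod_normE le_max/= lexx ?orbT.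
pose D := [set v | cmodulus (c v) <= rho].
have D0 : D !=set0 by exists (0, 0); rewrite /D/= /c/= (_ : 0 +i* 0 = 0)// cmodulus0.
have cD : compact D.
  apply: (@subclosed_compact _ _ (`[- rho, rho] `*` `[- rho, rho])).
  - rewrite (_ : D = (fun v => cmodulus (c v)) @^-1` [set x | x <= rho])//.
    apply: preimage_closed; last exact: closed_le.
    move=> w _; move: w; apply/continuous_subspace_setT.
    apply: (@lipschitz_within_continuous _ _ _ _ _ 2) => // u v _ _.
    exact: le_trans (ler_dist_cmodulus _ _) (cB _ _).
  - by apply: compact_setX; exact: segment_compact.
  - move=> [x y]; rewrite /D/= => xy; rewrite !in_itv/= -!ler_norml.
    by rewrite (le_trans (ler_Re_cmodulus _ _) xy) (le_trans (ler_Im_cmodulus _ _) xy).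
pose h v := cmodulus (F (c v) - c v).
have [|v Dv hv] := @compact_EVT_min _ _ h D D0 cD.
  (* [F] and the identity each contribute at most [|c u - c v|], which is at most twice the distance
     in [R * R]. *)
  apply: (@lipschitz_within_continuous _ _ _ _ _ 4) => // u v Du Dv.
  rewrite (le_trans (ler_dist_cmodulus _ _))//.
  rewrite (_ : _ - _ = (F (c u) - F (c v)) - (c u - c v)); last by ring.
  rewrite (le_trans (ler_cmodulusB _ _))//.
  have := Fq _ _ Du Dv; have := cB u v; have := cmodulus_ge0 (c u - c v).
  move: (cmodulus (c u - c v)) (cmodulus (_ - F _)) `|u - v| => s t x s0 s1 s2.
  have qs : q * s <= 1 * s by rewrite ler_wpM2r// ltW.
  by lra.
move: Dv; rewrite inE /D /= => Dv; exists (c v) => //.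
apply/eqP; rewrite -subr_eq0; apply/eqP/cmodulus_eq0.
have Fc : F (c v) = c (complex.Re (F (c v)), complex.Im (F (c v))).
  by rewrite /c/=; case: (F _).
(* The minimum [s] is compared with the value of [h] at [F (c v)]: it gives [s <= t <= q * s], hence
   [s = 0]. *)
have := hv (complex.Re (F (c v)), complex.Im (F (c v))).
rewrite inE /D /h/= -Fc => /(_ (Frho _ Dv)) h1.
have h2 := Fq _ _ (Frho _ Dv) Dv; have h0 := cmodulus_ge0 (F (c v) - c v).
apply/eqP; rewrite eq_le h0 andbT; move: h0 h1 h2.
set s := cmodulus (F (c v) - c v); set t := cmodulus (F (F _) - _) => s0 st ts; nra.
Qed.

(** * Covers of the unit circle *)

(** For [s <= t], the half difference [x] lies in [[0, pi - x0]] and has [sin x < sin x0], which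
    excludes [[x0, pi - x0]]. So [x < x0], and there [sin x >= cos x0 * x]. *)
Lemma expi_arc_le_chord (R : realType) (x0 s t d : R) : 0 < x0 -> x0 < pi / 2 ->
  x0 <= s <= 2 * pi - x0 -> x0 <= t <= 2 * pi - x0 ->
  cmodulus (expi t - expi s) <= d -> d <= sin x0 -> `|t - s| <= d / cos x0.
Proof.
move=> x0_gt0 x0_lt.
have c0 : 0 < cos x0 by rewrite cos_gt0_pihalf// x0_lt andbT; lra.
have pi0 : 0 < pi :> R by exact: pi_gt0.
wlog st : s t / s <= t => [H|] /andP[s0 s1] /andP[t0 t1].
  have [/H|/ltW/H] := leP s t; first by apply; apply/andP.
  by rewrite distrC cmodulusB; apply; apply/andP.
rewrite cmodulus_expiB [`|t - s|]ger0_norm ?subr_ge0// => chord ds.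
have sx0 : 0 < sin x0 by rewrite sin_gt0_pi// x0_gt0/=; lra.
set x := (t - s) / 2 in chord.
have x_ge0 : 0 <= x by rewrite /x; lra.
have tsx : t - s = 2 * x by rewrite /x; lra.
have sx : sin x <= `|sin x| := ler_norm _.
have xx0 : x < x0.
  rewrite ltNge; apply/negP => x0x.
  by have := @sin_ge_away _ x x0; lra.
have := @sin_ge_mul_cos _ x x0.
rewrite x_ge0 (ltW xx0) => /(_ isT x0_lt) h.
by rewrite ler_pdivlMr// tsx; nra.
Qed.

(** The right-hand side tends to [pi] as [x] tends to 0. Removing an arc of half-width [x] and
    losing a factor [cos x] therefore costs as little of the circle as desired. *)
Lemma exists_angle (R : realType) (k : R) : k < 1 ->
  exists2 x : R, 0 < x < pi / 2 & pi * k <= cos x * (pi - x).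
Proof.
move=> k1.
have pi0 : 0 < pi :> R by exact: pi_gt0.
have : (fun x : R => cos x * (pi - x)) x @[x --> 0] --> cos 0 * (pi - 0).
  by apply: cvgM; [exact: continuous_cos|apply: cvgB; [exact: cvg_cst|exact: cvg_id]].
move=> /cvgrPdist_lt /(_ (pi * (1 - k))) [|e /= e0 he].
  by rewrite mulr_gt0// subr_gt0.
exists (Num.min (e / 2) (pi / 4)).
  by rewrite lt_min gt_min !divr_gt0//=; apply/orP; right; lra.
set x := Num.min _ _.
have x0 : 0 < x by rewrite lt_min !divr_gt0.
have xe : x < e by rewrite gt_min; apply/orP; left; lra.
have := he x; rewrite /ball_/= sub0r normrN gtr0_norm// => /(_ xe).
rewrite cos0 subr0 mul1r => /ltr_normlW; lra.
Qed.

(* The arc is cut at angle 0 so that a short chord forces a small difference of angles. *)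
Lemma expi_cover_length (R : realType) (k : R) : k < 1 ->
  exists2 delta : R, 0 < delta &
    forall (V : nat -> set R) (d : nat -> R),
      (forall i, 0 <= d i <= delta) ->
      (forall i s t, V i s -> V i t -> cmodulus (expi t - expi s) <= d i) ->
      (forall t, 0 <= t <= 2 * pi -> exists i, V i t) ->
      ((2 * pi * k)%:E <= \sum_(0 <= i <oo) (d i)%:E)%E.
Proof.
move=> k1; have [x0 /andP[x0_gt0 x0_lt] hx0] := exists_angle k1.
have pi0 : 0 < pi :> R by exact: pi_gt0.
have c0 : 0 < cos x0 by rewrite cos_gt0_pihalf// x0_lt andbT; lra.
exists (sin x0) => [|V d dd chord cov]; first by rewrite sin_gt0_pi// x0_gt0/=; lra.
(* Angles within [x0] of the cut are discarded, so each remaining piece fits in an interval of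
   length [d i / cos x0]. If [W i] is empty, its infimum is a default value and [I i] is one more
   interval of that length. *)
pose W i := V i `&` [set t | x0 <= t <= 2 * pi - x0].
have hm i t : W i t -> inf (W i) <= t <= inf (W i) + d i / cos x0.
  move=> Wt; have W0 : W i !=set0 by exists t.
  apply/andP; split; first by apply: ge_inf => //; exists x0 => u [_ /andP[]].
  rewrite -lerBlDr; apply: lb_le_inf => // u Wu; rewrite lerBlDr -lerBlDl.
  rewrite (le_trans (ler_norm _))//.
  apply: expi_arc_le_chord => //; [exact: Wu.2|exact: Wt.2|exact: chord Wu.1 Wt.1|].
  by case/andP: (dd i).
pose I i : set R := `[inf (W i), inf (W i) + d i / cos x0]%classic.
have mI i : lebesgue_measure (I i) = ((cos x0)^-1 * d i)%:E.
  rewrite lebesgue_measure_itv/= lte_fin ltrDl mulrC.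
  have /andP[+ _] := dd i; rewrite le_eqVlt => /predU1P[<-|di0].
    by rewrite mulr0 ltxx.
  by rewrite mulr_gt0 ?invr_gt0// -EFinD addrAC subrr add0r.
have : (lebesgue_measure (`[x0, (2 * pi - x0)%R]%classic : set R) <=
    \sum_(0 <= i <oo) lebesgue_measure (I i))%E.
  apply: measure_sigma_subadditive => //.
    by move=> i; exact: measurable_itv.
  move=> t; rewrite /= in_itv/= => tx.
  have [|i Vi] := cov t; first by move: tx => /andP[]; lra.
  by exists i => //; rewrite /I/= in_itv/=; apply: hm.
(* Thus [2 * pi - 2 * x0] is at most the sum of the [d i] divided by [cos x0], and the choice of
   [x0] concludes. *)
rewrite lebesgue_measure_itv/= lte_fin ifT; last by lra.
under eq_eseriesr do rewrite mI EFinM.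
rewrite nneseriesZl; last by move=> i _; rewrite lee_fin; case/andP: (dd i).
rewrite lee_pdivlMl// => h; apply: le_trans h.
rewrite -EFinD -EFinM lee_fin; lra.
Qed.

(** * Length of a lift of the circle *)

Lemma continuous_complex_lipschitz (R : realType) (f : R -> R[i]^o) (k : R) :
  0 <= k -> (forall s t, cmodulus (f t - f s) <= k * `|t - s|) -> continuous f.
Proof.
move=> k0 fk t; apply/cvgrPdist_lt => e e0.
have k1 : 0 < k + 1 by rewrite ltr_wpDl.
(* The norm of [R[i]^o] takes values in [R[i]], whose order makes every positive element real. *)
have {e0}[e' e'0 ->] : exists2 x : R, 0 < x & e = x%:C.
  move: e e0 => [x y]; rewrite ltcE/= => /andP[/eqP -> x0].
  by exists x.
near=> s.
rewrite normr_cmodulus ltcR (le_lt_trans (fk _ _))//.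
rewrite (@le_lt_trans _ _ ((k + 1) * `|t - s|))//.
  by rewrite ler_wpM2r// lerDl.
rewrite mulrC -ltr_pdivlMr//; near: s.
by apply: (@cvgr_dist_lt _ _ _ (nbhs t)) => //; rewrite divr_gt0.
Unshelve. all: by end_near. Qed.

Lemma ediam_ge0 (R : realType) (U : set R[i]) : (0 <= ediam U)%E.
Proof. by apply: ereal_sup_ubound; left. Qed.

Lemma cmodulus_le_ediam (R : realType) (U : set R[i]) z w :
  U z -> U w -> ((cmodulus (z - w))%:E <= ediam U)%E.
Proof. by move=> Uz Uw; apply: ereal_sup_ubound; right; exists (z, w). Qed.

(** A cover of [C] by sets [U i] pulls back along [zeta] to a cover of the angles, with chords at
    most [M] times the diameter of [U i]. The bound for covers of the circle applies with
    [k = M * r]. *)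
Lemma hausdorff1_lift_circle (R : realType) (zeta : R -> R[i]) (C : set R[i])
    (M r : R) : 0 < M -> M * r < 1 ->
  (forall t, C (zeta t)) ->
  (forall s t, cmodulus (expi t - expi s) <= M * cmodulus (zeta t - zeta s)) ->
  ((2 * pi * r)%:E <= hausdorff1 C)%E.
Proof.
move=> M0 Mr Czeta Mzeta.
have [delta delta0 H] := expi_cover_length Mr.
(* The mesh [delta / M] keeps the rescaled diameters [d i] below [delta]. *)
apply: (@le_trans _ _ (hausdorff1_premeasure (delta / M) C)); last first.
  by apply: ereal_sup_ubound; exists (delta / M) => //=; rewrite divr_gt0.
apply: le_ereal_inf_tmp => _ [U [CU dU] <-].
have fU i : ediam (U i) = (fine (ediam (U i)))%:E.
  rewrite fineK// ge0_fin_numE ?ediam_ge0//.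
  by rewrite (le_lt_trans (dU i))// ltry.
pose d i := M * fine (ediam (U i)).
have := H (fun i => [set t | U i (zeta t)]) d.
have -> : (\sum_(0 <= i <oo) (d i)%:E = M%:E * \sum_(0 <= i <oo) ediam (U i))%E.
  rewrite -nneseriesZl; last by move=> i _; exact: ediam_ge0.
  by apply: eq_eseriesr => i _; rewrite /d EFinM -fU.
have -> : 2 * pi * r = M^-1 * (2 * pi * (M * r)).
  by rewrite mulrCA mulKf// gt_eqF.
move=> h; rewrite EFinM lee_pdivrMl//; apply: h.
- move=> i; apply/andP; split; first by rewrite mulr_ge0 ?(ltW M0)// fine_ge0 ?ediam_ge0.
  by rewrite /d mulrC -ler_pdivlMr// -lee_fin -fU dU.
- move=> i s t /= Us Ut; rewrite /d (le_trans (Mzeta _ _))// ler_pM2l//.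
  by rewrite -lee_fin -fU; exact: cmodulus_le_ediam.
- move=> t _; have [i _ Ui] := CU _ (Czeta t); by exists i.
Qed.

(** * A long component for perturbations of a linear polynomial *)

Lemma lemniscate_long_component (R : realType) (p : {poly R[i]}) (a : R[i])
    (rho L r : R) : 0 <= rho -> L < cmodulus a -> 0 <= L ->
  (cmodulus a + L) * r < 1 ->
  (forall z, cmodulus z <= rho -> 1 + cmodulus (p.[z] - a * z) <= cmodulus a * rho) ->
  (forall z w, cmodulus z <= rho -> cmodulus w <= rho ->
    cmodulus ((p.[z] - a * z) - (p.[w] - a * w)) <= L * cmodulus (z - w)) ->
  exists2 C : set R[i], is_component (lemniscate p) C &
    ((2 * pi * r)%:E <= hausdorff1 C)%E.
Proof.
move=> rho0 La L0 Mr small lip; pose g z := p.[z] - a * z.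
have a_gt0 : 0 < cmodulus a by exact: le_lt_trans La.
have a0 : a != 0 by apply: contraTneq a_gt0 => ->; rewrite cmodulus0 ltxx.
have pE z : p.[z] = a * z + g z by rewrite /g addrC subrK.
(* The bound [small] makes the map preserve the disk, and its contraction factor is [L / |a|]. *)
have /choice[zeta zetaP] t : exists z, cmodulus z <= rho /\ p.[z] = expi t.
  have [||||z zrho zE] := @disk_contraction_fixpoint _ rho (L / cmodulus a)
    (fun z => (expi t - g z) / a) => //.
  - by rewrite ltr_pdivrMr// mul1r.
  - move=> z zrho; rewrite cmodulusM cmodulusV ler_pdivrMr// mulrC.
    by rewrite (le_trans (ler_cmodulusB _ _))// cmodulus_expi small.
  - move=> z w zrho wrho; rewrite -mulrBl cmodulusM cmodulusV mulrAC ler_pM2r ?invr_gt0//.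
    have -> : expi t - g z - (expi t - g w) = - (g z - g w) by ring.
    by rewrite cmodulusN lip.
  by exists z; split=> //; rewrite pE -{1}zE mulrC divfK// subrK.
have zetaB s t : expi t - expi s = a * (zeta t - zeta s) + (g (zeta t) - g (zeta s)).
  by rewrite -(zetaP t).2 -(zetaP s).2 !pE; ring.
have zeta_lip s t : cmodulus (g (zeta t) - g (zeta s)) <= L * cmodulus (zeta t - zeta s).
  by apply: lip; [exact: (zetaP t).1|exact: (zetaP s).1].
have Czeta t : lemniscate p (zeta t).
  by rewrite /lemniscate/= (zetaP t).2 cmodulus_expi.
exists (connected_component (lemniscate p : set R[i]^o) (zeta 0)).
  by exists (zeta 0).
apply: (@hausdorff1_lift_circle _ zeta _ (cmodulus a + L)) => //.
- by rewrite ltr_wpDr.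
- move=> t; apply: (@connected_component_max _ _ (range (zeta : R -> R[i]^o))).
  + by exists 0.
  + by move=> _ [s _ <-]; exact: Czeta.
  + apply: connected_continuous_connected.
      by apply/connected_intervalP.
    apply: continuous_subspaceT.
    (* [zeta] was chosen pointwise. Its continuity comes from [|a| |zeta u - zeta s| <= |expi u -
       expi s| + L |zeta u - zeta s|], solved for the increment of [zeta]. *)
    apply: (@continuous_complex_lipschitz _ _ (cmodulus a - L)^-1) => [|s u].
      by rewrite invr_ge0 subr_ge0 ltW.
    rewrite mulrC ler_pdivlMr ?subr_gt0// (le_trans _ (expi_lipschitz s u))//.
    have : a * (zeta u - zeta s) = (expi u - expi s) - (g (zeta u) - g (zeta s)).
      by rewrite zetaB addrK.
    move=> /(congr1 (@cmodulus R)); rewrite cmodulusM => e.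
    have := ler_cmodulusB (expi u - expi s) (g (zeta u) - g (zeta s)).
    by have := zeta_lip s u; rewrite -e; lra.
  + by exists t.
- move=> s t; rewrite zetaB (le_trans (ler_cmodulusD _ _))// cmodulusM mulrDl.
  by rewrite lerD2l.
Qed.

(** * Gaussian mass of rectangles and tails *)

Section gaussian_mass.
Variable R : realType.
Local Notation mR := (measurableTypeR R).
Local Notation mu2 := (@lebesgue_measure R \x @lebesgue_measure R)%E.
Local Notation dens := (fun z : mR * mR => std_complex_gaussian_density (z.1 +i* z.2)).

Lemma std_complex_gaussian_densityE (x y : R) :
  std_complex_gaussian_density (x +i* y) = pi^-1 * expR (- (x ^+ 2 + y ^+ 2)).
Proof.
by rewrite /std_complex_gaussian_density cmodulus_sqrt sqr_sqrtr ?addr_ge0 ?sqr_ge0.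
Qed.

Lemma std_complex_gaussian_density_ge0 (z : R[i]) :
  0 <= std_complex_gaussian_density z.
Proof. by rewrite mulr_ge0 ?invr_ge0 ?pi_ge0 ?expR_ge0. Qed.

Lemma measurable_sqr_cmodulus :
  measurable_fun [set: mR * mR] (fun z => z.1 ^+ 2 + z.2 ^+ 2 : R).
Proof.
by apply: measurable_funD; apply: measurable_funX;
  [exact: measurable_fst|exact: measurable_snd].
Qed.

Lemma measurable_std_complex_gaussian_density :
  measurable_fun [set: mR * mR] (fun z => (dens z)%:E).
Proof.
apply/measurable_EFinP; under eq_fun do rewrite std_complex_gaussian_densityE.
apply: measurable_funM; first exact: measurable_cst.
apply: measurableT_comp; first exact: measurable_expR.
by apply: measurableT_comp => //; exact: measurable_sqr_cmodulus.
Qed.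

Lemma gaussian_rectangle_gt0 (a b c d : R) : a < b -> c < d ->
  exists2 m : R, 0 < m &
    (m%:E <= \int[mu2]_(z in (`[a, b] `*` `[c, d] : set (mR * mR))) (dens z)%:E)%E.
Proof.
(* On the rectangle [x ^+ 2 <= a ^+ 2 + b ^+ 2] whatever the signs, and likewise for [y], so [k]
   bounds the density from below. *)
move=> ab cd; pose k : R := pi^-1 * expR (- ((a ^+ 2 + b ^+ 2) + (c ^+ 2 + d ^+ 2))).
have k0 : 0 < k by rewrite mulr_gt0 ?invr_gt0 ?pi_gt0 ?expR_gt0.
exists (k * ((b - a) * (d - c))).
  by apply: mulr_gt0 => //; apply: mulr_gt0; rewrite subr_gt0.
have mD : measurable (`[a, b] `*` `[c, d] : set (mR * mR)).
  by apply: measurableX; exact: measurable_itv.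
have mu_itv (u v : R) : u < v ->
    lebesgue_measure (`[u, v]%classic : set R) = (v - u)%:E.
  by move=> uv; rewrite lebesgue_measure_itv/= lte_fin uv -EFinD.
have muD : mu2 (`[a, b] `*` `[c, d] : set (mR * mR)) = ((b - a) * (d - c))%:E.
  rewrite [LHS]product_measure1E; [|exact: measurable_itv|exact: measurable_itv].
  by rewrite EFinM; congr (_ * _)%E; exact: mu_itv.
apply: (@le_trans _ _ (\int[mu2]_(z in (`[a, b] `*` `[c, d] : set (mR * mR))) k%:E)%E).
  by rewrite integral_cst// [X in (_ <= _ * X)%E]muD -EFinM.
apply: ge0_le_integral => //.
- by move=> z _; rewrite lee_fin ltW.
- exact: measurable_funTS measurable_std_complex_gaussian_density.
move=> [x y] [] /=; rewrite !in_itv/= => /andP[ax xb] /andP[cy yd].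
rewrite lee_fin std_complex_gaussian_densityE ler_pM2l ?invr_gt0 ?pi_gt0//.
have sqr_le (u v w : R) : u <= w -> w <= v -> w ^+ 2 <= u ^+ 2 + v ^+ 2.
  by move=> uw wv; have [w0|w0] := leP 0 w; nra.
by rewrite ler_expR lerN2 lerD// sqr_le.
Qed.

Lemma normal_pdf_mul (x y : R) : normal_pdf 0 1 x * normal_pdf 0 1 y =
  (2 * pi)^-1 * expR (- ((x ^+ 2 + y ^+ 2) / 2)).
Proof.
rewrite !normal_pdfE ?oner_neq0// /normal_fun /normal_peak !subr0 !expr1n mul1r.
have sqrt2 : (Num.sqrt (pi *+ 2) : R) ^+ 2 = 2 * pi.
  rewrite sqr_sqrtr; first by rewrite mulr_natl.
  by rewrite mulrn_wge0 ?pi_ge0.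
rewrite [LHS]mulrACA -invfM -expr2 sqrt2; congr (_ * _).
by rewrite -expRD; congr expR; field.
Qed.

Lemma integral_gaussian_product :
  (\int[mu2]_z (normal_pdf 0 1 z.1 * normal_pdf 0 1 z.2)%:E = 1)%E.
Proof.
pose f (z : mR * mR) : \bar R := (normal_pdf 0 1 z.1 * normal_pdf 0 1 z.2)%:E.
have mpdf : measurable_fun [set: mR] (normal_pdf 0 1 : mR -> mR).
  exact: measurable_normal_pdf.
rewrite -[LHS]/(\int[mu2]_z f z)%E (fubini_tonelli1 f); last 2 first.
- apply/measurable_EFinP; apply: measurable_funM.
    exact: (measurableT_comp mpdf measurable_fst).
  exact: (measurableT_comp mpdf measurable_snd).
- by move=> z; rewrite lee_fin mulr_ge0 ?normal_pdf_ge0.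
rewrite -[RHS](@integral_normal_pdf R 0 1).
apply: eq_integral => x _; rewrite /fubini_F /f/=.
under eq_integral do rewrite EFinM.
rewrite ge0_integralZl//; last 3 first.
- by apply/measurable_EFinP; exact: mpdf.
- by move=> y _; rewrite lee_fin normal_pdf_ge0.
- by rewrite lee_fin normal_pdf_ge0.
by rewrite integral_normal_pdf// mule1.
Qed.

Lemma measurable_sqr_cmodulus_gt (t : R) :
  measurable [set z : mR * mR | t < z.1 ^+ 2 + z.2 ^+ 2].
Proof.
rewrite (_ : [set z | _] = setT `&` (fun z : mR * mR => z.1 ^+ 2 + z.2 ^+ 2) @^-1` `]t, +oo[).
  exact: (measurable_sqr_cmodulus measurableT (measurable_itv _)).
by apply/seteqP; split=> z /=; rewrite in_itv/= andbT => // -[].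
Qed.

(** The density is [2 * expR (- |z|^2 / 2)] times the product of two real standard normal densities.
    The first factor is at most [2 * expR (- (t / 2))] on the tail, and the second has integral
    1. *)
Lemma gaussian_tail (t : R) :
  (\int[mu2]_(z in [set z : mR * mR | (t < z.1 ^+ 2 + z.2 ^+ 2)%R]) (dens z)%:E <=
    (2 * expR (- (t / 2)))%:E)%E.
Proof.
have mD := measurable_sqr_cmodulus_gt t.
have mpdf2 : measurable_fun [set: mR * mR]
    (fun z : mR * mR => (normal_pdf 0 1 z.1 * normal_pdf 0 1 z.2)%:E).
  have mpdf : measurable_fun [set: mR] (normal_pdf 0 1 : mR -> mR).
    exact: measurable_normal_pdf.
  apply/measurable_EFinP; apply: measurable_funM.
    exact: (measurableT_comp mpdf measurable_fst).
  exact: (measurableT_comp mpdf measurable_snd).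
set k := 2 * _; have k0 : 0 <= k by rewrite mulr_ge0 ?expR_ge0.
apply: (@le_trans _ _
    (\int[mu2]_z (k%:E * (normal_pdf 0 1 z.1 * normal_pdf 0 1 z.2)%:E))%E); last first.
  rewrite ge0_integralZl//; first by rewrite integral_gaussian_product mule1.
  by move=> z _; rewrite lee_fin mulr_ge0 ?normal_pdf_ge0.
have m1 : measurable_fun [set: mR * mR]
    (fun z : mR * mR => (k%:E * (normal_pdf 0 1 z.1 * normal_pdf 0 1 z.2)%:E)%E).
  exact: measurable_funeM.
apply: (@le_trans _ _ (\int[mu2]_(z in [set z : mR * mR | (t < z.1 ^+ 2 + z.2 ^+ 2)%R])
    (k%:E * (normal_pdf 0 1 z.1 * normal_pdf 0 1 z.2)%:E))%E); last first.
  apply: ge0_subset_integral => // z _.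
  by rewrite mule_ge0 ?lee_fin// mulr_ge0 ?normal_pdf_ge0.
apply: ge0_le_integral => //.
- by move=> z _; rewrite lee_fin std_complex_gaussian_density_ge0.
- exact: measurable_funTS measurable_std_complex_gaussian_density.
- exact: measurable_funTS.
move=> [x y] /= txy; rewrite -EFinM lee_fin std_complex_gaussian_densityE.
have -> : k * (normal_pdf 0 1 x * normal_pdf 0 1 y) =
    pi^-1 * expR (- (t / 2) + - ((x ^+ 2 + y ^+ 2) / 2)).
  rewrite normal_pdf_mul expRD /k.
  by move: (pi : R) (lt0r_neq0 (pi_gt0 R)) => q q0; field.
rewrite ler_pM2l ?invr_gt0 ?pi_gt0// ler_expR; lra.
Qed.

End gaussian_mass.

(** * Products with geometrically small deficits *)

(** From some [N] on the deficits sum to at most 1/2, and a product of numbers in []0, 1]] is at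
    least 1 minus the sum of their deficits. *)
Lemma prod_lower_bound (R : realType) (l : nat -> R) (C x : R) (k0 : nat) :
  0 <= C -> 0 < x -> x < 1 -> (forall k, 0 < l k <= 1) ->
  (forall k, (k0 <= k)%N -> 1 - l k <= C * x ^+ k) ->
  exists2 c, 0 < c & forall n, c <= \prod_(k < n) l k.
Proof.
move=> C0 x0 x1 l01 lC.
have x1' : 0 < 1 - x by rewrite subr_gt0.
have [N k0N hN] : exists2 N, (k0 <= N)%N & C / (1 - x) * x ^+ N <= 2^-1.
  have : C / (1 - x) * x ^+ n @[n --> \oo] --> C / (1 - x) * 0.
    apply: cvgM; first exact: cvg_cst.
    by apply: cvg_expr; rewrite gtr0_norm.
  move=> /cvgrPdist_le /(_ (2^-1)) [|N _ hN]; first by rewrite invr_gt0.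
  exists (maxn k0 N); first exact: leq_maxl.
  have := hN (maxn k0 N) (leq_maxr _ _).
  by rewrite mulr0 sub0r normrN; apply: le_trans; rewrite ler_norm.
(* [u j] is the geometric sum of [C * x ^+ k] over [N <= k < N + j]. *)
pose u j := C / (1 - x) * x ^+ N * (1 - x ^+ j).
have uS j : u j.+1 = u j + C * x ^+ (N + j).
  by rewrite /u exprS exprD; field; rewrite gt_eqF.
have u_ge0 j : 0 <= u j.
  rewrite mulr_ge0 ?subr_ge0 ?exprn_ile1 ?(ltW x0) ?(ltW x1)//.
  by rewrite mulr_ge0 ?exprn_ge0 ?divr_ge0 ?(ltW x0) ?(ltW x1').
have u_le j : u j <= 2^-1.
  rewrite (le_trans _ hN)// ler_piMr//; last by rewrite gerBl exprn_ge0 ?ltW.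
  by rewrite mulr_ge0 ?exprn_ge0 ?divr_ge0 ?(ltW x0) ?(ltW x1').
pose c0 := \prod_(k < N) l k.
have prod_gt0 n : 0 < \prod_(k < n) l k.
  by apply: prodr_gt0 => k _; case/andP: (l01 k).
have tail j : c0 * (1 - u j) <= \prod_(k < N + j) l k.
  elim: j => [|j IH]; first by rewrite addn0 /u expr0 subrr mulr0 subr0 mulr1.
  rewrite addnS big_ord_recr/= uS.
  have := lC (N + j)%N (leq_trans k0N (leq_addr _ _)).
  have : 0 <= C * x ^+ (N + j) by rewrite mulr_ge0// exprn_ge0 ?ltW.
  have := l01 (N + j)%N; have := u_ge0 j; have := u_le j; have := prod_gt0 N.
  rewrite -/c0; move: IH; move: (C * _) (\prod_(k < N + j) _) (l _) (u j).
  move=> e Q y v IH c00 v1 v0 /andP[y0 y1] e0 ye.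
  apply: (@le_trans _ _ (c0 * (1 - v) * y)); last by rewrite ler_pM2r.
  by rewrite -mulrA ler_pM2l//; nra.
have antitone n j : \prod_(k < n + j) l k <= \prod_(k < n) l k.
  elim: j => [|j IH]; first by rewrite addn0.
  rewrite addnS big_ord_recr/= (le_trans _ IH)// ler_piMr ?(ltW (prod_gt0 _))//.
  by case/andP: (l01 (n + j)%N).
exists (c0 / 2) => [|n]; first by rewrite divr_gt0// prod_gt0.
(* Adding [N] further factors only lowers the product, so [n < N] needs no separate case. *)
rewrite (le_trans _ (antitone n N))// addnC (le_trans _ (tail n))//.
rewrite ler_pM2l ?prod_gt0//; have := u_le n; lra.
Qed.

(** * Probability bounds for one Gaussian coefficient *)

Section gaussian_probability.
Variable R : realType.
Local Notation mR := (measurableTypeR R).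

(** Quantifying over all probability spaces makes [m] depend on [B] alone, so that the final
    constant depends neither on the space nor on [n]. *)
Definition gaussian_ge (m : R) (B : set (mR * mR)) : Prop :=
  forall (d : measure_display) (T : measurableType d) (P : probability T R)
    (X : T -> R[i]), std_complex_gaussian P X ->
  (m%:E <= P ((@plane_of_complex R \o X) @^-1` B))%E.

Lemma measurable_sqr_cmodulus_le (t : R) :
  measurable [set z : mR * mR | z.1 ^+ 2 + z.2 ^+ 2 <= t].
Proof.
rewrite (_ : [set z | _] = ~` [set z | t < z.1 ^+ 2 + z.2 ^+ 2]).
  by apply: measurableC; exact: measurable_sqr_cmodulus_gt.
by apply/seteqP; split=> z /=;
  [move=> h; apply/negP; rewrite -leNgt|move/negP; rewrite -leNgt].
Qed.

Lemma gaussian_ge_rectangle (a b c d : R) : a < b -> c < d ->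
  exists2 m, 0 < m & gaussian_ge m (`[a, b] `*` `[c, d]).
Proof.
move=> ab cd; have [m m0 hm] := gaussian_rectangle_gt0 ab cd.
exists m => // dd T P X [_ XP]; rewrite XP//.
by apply: measurableX; exact: measurable_itv.
Qed.

Lemma gaussian_geW (m m' : R) B : m' <= m -> gaussian_ge m B -> gaussian_ge m' B.
Proof.
move=> mm h d T P X XP; apply: (le_trans _ (h d T P X XP)).
by rewrite lee_fin.
Qed.

(** In the tail bound, [expR (t / 2) >= t / 2] gives [2 * expR (- (t / 2)) <= 4 / t]. *)
Lemma gaussian_ge_disk_large (t : R) : 0 < t ->
  gaussian_ge (1 - 4 / t) [set z | z.1 ^+ 2 + z.2 ^+ 2 <= t].
Proof.
move=> t0 d T P X [mX XP]; pose B := [set z : mR * mR | t < z.1 ^+ 2 + z.2 ^+ 2].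
have mB : measurable B by exact: measurable_sqr_cmodulus_gt.
have mXB : measurable ((@plane_of_complex R \o X) @^-1` B).
  by rewrite -[X in measurable X]setTI; exact: mX.
rewrite (_ : _ @^-1` _ = ~` ((@plane_of_complex R \o X) @^-1` B)); last first.
  by apply/seteqP; split=> w /=; rewrite /B/=;
    [move=> h; apply/negP; rewrite -leNgt|move/negP; rewrite -leNgt].
rewrite probability_setC// EFinB leeB// XP//.
apply: (le_trans (gaussian_tail t)); rewrite lee_fin expRN.
have t2 : 0 < t / 2 by rewrite divr_gt0.
have -> : 4 / t = 2 * (t / 2)^-1 by field; rewrite gt_eqF.
rewrite ler_pM2l// lef_pV2 ?posrE ?expR_gt0//.
by rewrite (le_trans _ (expR_ge1Dx _))// lerDr.
Qed.

(** For [t <= 4] the bound [1 - 4 / t] is not positive; a square inside the disk then supplies a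
    positive one. *)
Lemma gaussian_ge_disk (t : R) : 0 < t ->
  exists m, [/\ 0 < m <= 1, 1 - m <= 4 / t &
    gaussian_ge m [set z | z.1 ^+ 2 + z.2 ^+ 2 <= t]].
Proof.
(* The square [[0, s]^2] lies in the disk: [s <= 1] and [s <= t / 2] give [2 * s ^+ 2 <= t]. *)
move=> t0; pose s : R := Num.min 1 (t / 2).
have s0 : 0 < s by rewrite lt_min ltr01 divr_gt0.
have [m m0 hm] := gaussian_ge_rectangle s0 s0.
have t4 : 0 < 4 / t by rewrite divr_gt0.
exists (Num.min 1 (Num.max m (1 - 4 / t))); split.
- by rewrite lt_min ltr01 lt_max m0 ge_min lexx.
- by rewrite lerBlDr -lerBlDl le_min lerBlDr lerDl ltW// le_max lexx orbT.
have [mt|tm] := leP m (1 - 4 / t).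
  by apply: gaussian_geW (gaussian_ge_disk_large t0); rewrite ge_min lexx orbT.
move=> d T P X XP; apply: (@le_trans _ _ m%:E).
  by rewrite lee_fin ge_min lexx orbT.
have [mX _] := XP; apply: (le_trans (hm d T P X XP)); apply: le_measure.
- rewrite inE -[X in measurable X]setTI; apply: mX => //.
  by apply: measurableX; exact: measurable_itv.
- by rewrite inE -[X in measurable X]setTI; apply: mX => //; exact: measurable_sqr_cmodulus_le.
move=> w /=; rewrite !in_itv/=; move: (complex.Re _) (complex.Im _) => x y.
have s1 : s <= 1 by rewrite ge_min lexx.
have st : s <= t / 2 by rewrite ge_min lexx orbT.
by move: (s) s0 s1 st => q q0 q1 qt [/andP[x0 x1] /andP[y0 y1]]; nra.
Qed.

End gaussian_probability.

(** * Power sums with small coefficients *)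

(** Induction on [k]: the constants [c k = sigma ^+ k / (sigma - rho)] satisfy
    [c k.+1 = rho * c k + sigma ^+ k]. Being geometric in [k], they can be summed against
    [q ^+ k]. *)
Lemma expr_lipschitz (R : realType) (rho sigma : R) (z w : R[i]) k :
  rho < sigma -> cmodulus z <= rho -> cmodulus w <= rho ->
  cmodulus (z ^+ k - w ^+ k) <= sigma ^+ k / (sigma - rho) * cmodulus (z - w).
Proof.
move=> rs zr wr; have rho0 : 0 <= rho := le_trans (cmodulus_ge0 z) zr.
have sr : 0 < sigma - rho by rewrite subr_gt0.
elim: k => [|k IH].
  by rewrite !expr0 subrr cmodulus0 mul1r mulr_ge0 ?cmodulus_ge0 ?invr_ge0 ?ltW.
have -> : z ^+ k.+1 - w ^+ k.+1 = z * (z ^+ k - w ^+ k) + w ^+ k * (z - w).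
  by rewrite !exprS; ring.
have -> : sigma ^+ k.+1 / (sigma - rho) * cmodulus (z - w) =
    rho * (sigma ^+ k / (sigma - rho) * cmodulus (z - w)) + sigma ^+ k * cmodulus (z - w).
  by rewrite exprS; field; rewrite gt_eqF.
rewrite (le_trans (ler_cmodulusD _ _))// !cmodulusM cmodulusX lerD//.
  by rewrite ler_pM ?cmodulus_ge0.
rewrite ler_wpM2r ?cmodulus_ge0// lerXn2r ?nnegrE ?cmodulus_ge0 ?(le_trans wr) ?(ltW rs)//.
by rewrite (le_trans rho0) ?ltW.
Qed.

Lemma geometric_sum_le (R : realType) (x : R) n : 0 <= x -> x < 1 ->
  \sum_(k < n) x ^+ k <= (1 - x)^-1.
Proof.
move=> x0 x1; have x1' : 0 < 1 - x by rewrite subr_gt0.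
rewrite -[leRHS]mul1r ler_pdivlMr//.
have -> : (\sum_(k < n) x ^+ k) * (1 - x) = 1 - x ^+ n.
  by rewrite -[RHS]opprB subrX1; ring.
by rewrite gerBl exprn_ge0.
Qed.

Section perturbation.
Variables (R : realType) (rho sigma q eta : R) (n : nat) (b : 'I_n -> R[i]).
Hypotheses (rho0 : 0 <= rho) (rs : rho < sigma) (s1 : sigma < 1) (q0 : 0 < q)
  (qs : q * sigma < 1) (eta0 : 0 <= eta).
Hypothesis b_le : forall k, cmodulus (b k) <= eta * q ^+ k.
Let g z := \sum_(k < n) b k * z ^+ k.
(** Summing the Lipschitz constants of the terms gives [eta * K]; since [sigma - rho <= 1], this
    also bounds the modulus of [g]. *)
Let K := ((sigma - rho) * (1 - q * sigma))^-1.

Let sr : 0 < sigma - rho. Proof. by rewrite subr_gt0. Qed.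
Let s0 : 0 < sigma. Proof. exact: le_lt_trans rs. Qed.
Let sum_le : \sum_(k < n) (q * sigma) ^+ k <= (1 - q * sigma)^-1.
Proof. by apply: geometric_sum_le => //; rewrite mulr_ge0 ?ltW. Qed.

Lemma perturbation_lipschitz z w : cmodulus z <= rho -> cmodulus w <= rho ->
  cmodulus (g z - g w) <= eta * K * cmodulus (z - w).
Proof.
move=> zr wr; rewrite /g -sumrB (le_trans (ler_cmodulus_sum _ _ _))//.
apply: (@le_trans _ _
    (\sum_(k < n) eta * (sigma - rho)^-1 * cmodulus (z - w) * (q * sigma) ^+ k)).
  apply: ler_sum => k _; rewrite -mulrBr cmodulusM.
  have h := expr_lipschitz k rs zr wr.
  apply: (le_trans (ler_pM (cmodulus_ge0 _) (cmodulus_ge0 _) (b_le k) h)).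
  by rewrite exprMn le_eqVlt; apply/orP; left; apply/eqP; ring.
rewrite -mulr_sumr.
have -> : eta * K * cmodulus (z - w) =
    eta * (sigma - rho)^-1 * cmodulus (z - w) * (1 - q * sigma)^-1.
  by rewrite /K invfM; ring.
by rewrite ler_wpM2l// !mulr_ge0 ?cmodulus_ge0 ?invr_ge0 ?(ltW sr).
Qed.

Lemma perturbation_le z : cmodulus z <= rho -> cmodulus (g z) <= eta * K.
Proof.
move=> zr; rewrite /g (le_trans (ler_cmodulus_sum _ _ _))//.
apply: (@le_trans _ _ (\sum_(k < n) eta * (q * sigma) ^+ k)).
  apply: ler_sum => k _; rewrite cmodulusM cmodulusX exprMn mulrA.
  rewrite ler_pM ?cmodulus_ge0 ?exprn_ge0 ?cmodulus_ge0//.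
  rewrite lerXn2r ?nnegrE ?cmodulus_ge0 ?ltW//.
  exact: le_lt_trans rs.
rewrite -mulr_sumr ler_wpM2l// (le_trans sum_le)// /K invfM.
rewrite -[leLHS]mul1r ler_wpM2r ?invr_ge0 ?subr_ge0 ?(ltW qs)//.
rewrite -[leLHS]invr1 lef_pV2 ?posrE//.
by rewrite lerBlDr (le_trans (ltW s1))// lerDl.
Qed.

End perturbation.

(** * Regions for the coefficients *)

Lemma lee_prod_EFin (R : realType) (I : Type) (s : seq I) (Q : pred I) (l : I -> R)
    (F : I -> \bar R) :
  (forall i, 0 <= l i) -> (forall i, ((l i)%:E <= F i)%E) ->
  ((\prod_(i <- s | Q i) l i)%:E <= \prod_(i <- s | Q i) F i)%E.
Proof.
move=> l0 lF; suff /andP[] : (0 <= \prod_(i <- s | Q i) l i) &&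
  ((\prod_(i <- s | Q i) l i)%:E <= \prod_(i <- s | Q i) F i)%E by [].
elim/big_rec2: _ => [|i y x _ /andP[x0 xy]]; first by rewrite ler01 lexx.
by rewrite mulr_ge0//= EFinM lee_pmul ?lee_fin.
Qed.

Definition coef_region (R : realType) (alpha beta eta q : R) (k : nat) :
    set (measurableTypeR R * measurableTypeR R) :=
  if k == 1%N then `[alpha, beta] `*` `[0, eta]
  else [set z | z.1 ^+ 2 + z.2 ^+ 2 <= (eta * q ^+ k) ^+ 2].

Lemma measurable_coef_region (R : realType) (alpha beta eta q : R) k :
  measurable (coef_region alpha beta eta q k).
Proof.
rewrite /coef_region; case: eqP => _; last exact: measurable_sqr_cmodulus_le.
by apply: measurableX; exact: measurable_itv.
Qed.

Lemma coef_region_prob (R : realType) (alpha beta eta q : R) :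
  alpha < beta -> 0 < eta -> 1 < q ->
  exists l : nat -> R,
    [/\ forall k, 0 < l k <= 1,
        forall k, gaussian_ge (l k) (coef_region alpha beta eta q k) &
        exists2 c, 0 < c & forall n, c <= \prod_(k < n) l k].
Proof.
move=> ab eta0 q1; have q0 : 0 < q by exact: lt_trans q1.
(* With [t = (eta * q ^+ k) ^+ 2], the deficit [4 / t] is exactly [C * x ^+ k]. The rectangle at
   index 1 has no such estimate, so it is claimed from 2 on. *)
pose C := 4 / eta ^+ 2; pose x := (q ^+ 2)^-1.
have /choice[l lP] k : exists m, [/\ 0 < m <= 1, (2 <= k)%N -> 1 - m <= C * x ^+ k &
    gaussian_ge m (coef_region alpha beta eta q k)].
  rewrite /coef_region; case: eqP => [->|_].
    have [m m0 hm] := gaussian_ge_rectangle ab eta0.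
    exists (Num.min 1 m); split=> //; first by rewrite lt_min ltr01 m0 ge_min lexx.
    by apply: gaussian_geW hm; rewrite ge_min lexx orbT.
  have t0 : 0 < (eta * q ^+ k) ^+ 2 by rewrite !(exprn_gt0, mulr_gt0).
  have [m [m01 m1 hm]] := gaussian_ge_disk t0.
  exists m; split=> // _; rewrite (le_trans m1)//.
  have -> : x ^+ k = ((q ^+ k) ^+ 2)^-1 by rewrite /x exprVn -!exprM mulnC.
  by rewrite exprMn invfM mulrA.
exists l; split=> [k|k|]; [by case: (lP k)|by case: (lP k)|].
apply: (@prod_lower_bound _ l C x 2).
- by rewrite divr_ge0 ?exprn_ge0 ?ltW.
- by rewrite invr_gt0 exprn_gt0.
- by rewrite invf_lt1 ?exprn_gt0// exprn_egt1.
- by move=> k; case: (lP k).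
- by move=> k k2; case: (lP k) => _ /(_ k2).
Qed.

Lemma coef_region_long_component (R : realType) (r : R) : 0 < r -> r < 1 ->
  exists alpha beta eta q : R, [/\ alpha < beta, 0 < eta, 1 < q &
    forall (n : nat) (a : 'I_n.+1 -> R[i]), (1 <= n)%N ->
    (forall k : 'I_n.+1, coef_region alpha beta eta q k (plane_of_complex (a k))) ->
    exists2 C : set R[i], is_component (lemniscate (\sum_(k < n.+1) a k *: 'X^k)) C &
      ((2 * pi * r)%:E <= hausdorff1 C)%E].
Proof.
(* Midpoints give [r < rho < sigma < 1] and [1 < q] with [q * sigma = (1 + sigma) / 2 < 1]. *)
move=> r0 r1; pose rho := (1 + r) / 2; pose sigma := (1 + rho) / 2.
pose q := (1 + sigma^-1) / 2.
have rho_r : r < rho by rewrite /rho; lra.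
have rho_1 : rho < 1 by rewrite /rho; lra.
have rho_0 : 0 < rho by lra.
have sr : rho < sigma by rewrite /sigma; lra.
have s1 : sigma < 1 by rewrite /sigma; lra.
have s0 : 0 < sigma by lra.
have q1 : 1 < q by have : 1 < sigma^-1 by [rewrite invf_gt1]; rewrite /q; lra.
have q0 : 0 < q by lra.
have qs : q * sigma < 1.
  have : q * sigma = (sigma + 1) / 2 by rewrite /q; field; rewrite gt_eqF.
  by move=> ->; lra.
pose K := ((sigma - rho) * (1 - q * sigma))^-1.
have K0 : 0 < K by rewrite invr_gt0 mulr_gt0 ?subr_gt0.
(* The gap from [rho^-1] to [r^-1] is cut in three: [alpha] and [beta] are the inner points. As
   [eta + eta * K = rho * e < e], the last third absorbs the imaginary part of [a_1] and the
   Lipschitz constant, while [alpha * rho = 1 + rho * e] leaves room for the modulus of the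
   perturbation. *)
pose e := (r^-1 - rho^-1) / 3.
have e0 : 0 < e by rewrite divr_gt0// subr_gt0 ltf_pV2.
pose eta := rho * e / (1 + K).
have K1 : 0 < 1 + K by rewrite addr_gt0.
have eta0 : 0 < eta by apply: divr_gt0 => //; apply: mulr_gt0.
have etaK : eta + eta * K = rho * e.
  by rewrite /eta; field; rewrite gt_eqF.
have etaK0 : 0 < eta * K by rewrite mulr_gt0.
pose alpha := rho^-1 + e; pose beta := alpha + e.
have alpha_rho : alpha * rho = 1 + rho * e.
  by rewrite /alpha mulrDl mulVf ?gt_eqF// [e * _]mulrC.
have alpha0 : 0 < alpha by rewrite addr_gt0 ?invr_gt0.
have beta_r : beta = r^-1 - e by rewrite /beta /alpha /e; field; rewrite !gt_eqF.
have ab : alpha < beta by rewrite ltrDl.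
clearbody beta alpha eta e q sigma rho.
exists alpha, beta, eta, q; split=> //.
move=> n a n1 aP; pose i1 : 'I_n.+1 := Ordinal (n1 : (1 < n.+1)%N).
pose b k : R[i] := if k == i1 then 0 else a k.
have b_le k : cmodulus (b k) <= eta * q ^+ k.
  rewrite /b; case: eqP => [_|/eqP ki1].
    by rewrite cmodulus0 mulr_ge0 ?exprn_ge0 ?ltW.
  have := aP k; rewrite /coef_region ifF; last by apply/negbTE.
  case: (a k) => x y /= xy.
  rewrite cmodulus_sqrt -[leRHS]ger0_norm ?mulr_ge0 ?exprn_ge0 ?(ltW eta0) ?(ltW q0)//.
  by rewrite -sqrtr_sqr ler_wsqrtr.
set p := \sum_(k < n.+1) (a k *: 'X^k).
have pE z : p.[z] - a i1 * z = \sum_(k < n.+1) b k * z ^+ k.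
  rewrite horner_sum (bigD1 i1)//= [RHS](bigD1 i1)//= {1}/b eqxx mul0r add0r.
  rewrite !hornerE addrAC subrr add0r; apply: eq_bigr => j ji.
  by rewrite !hornerE /b (negbTE ji).
have [a1 a2] : alpha <= cmodulus (a i1) /\ cmodulus (a i1) <= beta + eta.
  have := aP i1; rewrite /coef_region eqxx.
  case: (a i1) => x y /= [] /=; rewrite !in_itv/= => /andP[x1 x2] /andP[y1 y2]; split.
    by rewrite (le_trans x1)// (le_trans (ler_norm _) (ler_Re_cmodulus x y)).
  rewrite (le_trans (cmodulus_le_ReIm _ _))// lerD// ger0_norm//.
  by rewrite (le_trans _ x1) ?ltW.
apply: (@lemniscate_long_component _ p (a i1) rho (eta * K) r (ltW rho_0)).
- by rewrite (lt_le_trans _ a1)//; nra.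
- exact: ltW.
- rewrite -ltr_pdivlMr// div1r; nra.
- move=> z zrho; rewrite pE.
  have h := perturbation_le (ltW rho_0) sr s1 q0 qs (ltW eta0) b_le zrho.
  rewrite -/K in h; rewrite (@le_trans _ _ (alpha * rho))//; last by rewrite ler_pM2r.
  by rewrite alpha_rho lerD2l (le_trans h)//; lra.
- move=> z w zr wr; rewrite !pE.
  by apply: perturbation_lipschitz => //; exact: ltW.
Qed.

(** * The event and its probability by independence *)

Theorem theorem4 (R : realType) (r : R) (r_gt0 : 0 < r) (r_lt1 : r < 1) :
  exists2 c : R, 0 < c &
    forall (n : nat), (1 <= n)%N ->
    forall (d : measure_display) (T : measurableType d) (P : probability T R)
           (a : 'I_n.+1 -> T -> R[i]),
      iid_std_complex_gaussian P a ->
      let p (w : T) : {poly R[i]} := \sum_(k < n.+1) a k w *: 'X^k in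
      exists E : set T,
        [/\ measurable E, (c%:E <= P E)%E &
            forall w, E w ->
              exists2 C : set R[i], is_component (lemniscate (p w)) C &
                ((2 * pi * r)%:E <= hausdorff1 C)%E].
Proof.
have [alpha [beta [eta [q [ab eta0 q1 long]]]]] := coef_region_long_component r_gt0 r_lt1.
have [l [l01 lP [c c0 cl]]] := coef_region_prob ab eta0 q1.
exists c => // n n1 d T P a [aG aI] p.
pose B (k : 'I_n.+1) := coef_region alpha beta eta q k.
have mB k : measurable (B k) by exact: measurable_coef_region.
exists (\bigcap_(k in [set` [set: 'I_n.+1]%SET]) ((@plane_of_complex R \o a k) @^-1` B k)).
split.
- apply: fin_bigcap_measurable => [|k _]; first exact: finite_finset.
  by rewrite -[X in measurable X]setTI; apply: (aG k).1.
(* Independence over the full index set turns the probability into a product of [n.+1] factors,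
   bounded below by [c] for every [n]. *)
- rewrite aI//; apply: (@le_trans _ _ (\prod_(k in [set: 'I_n.+1]%SET) l k)%:E).
    by rewrite lee_fin (eq_bigl xpredT) ?cl// => k; rewrite inE.
  apply: lee_prod_EFin => k; first by case/andP: (l01 k) => /ltW.
  exact: lP (aG k).
- move=> w Ew; apply: long => // k.
  by apply: Ew; rewrite /= inE.
Qed.
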